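(* Let $q$ be a prime power and let $\mathrm{Q}$ be a non-singular quadric of $\mathrm{PG}(N,q)$, where either $N\geq 6$, or $N=5$ and $\mathrm{Q}=\mathrm{Q}^-(5,q)$ is a non-singular elliptic quadric. Let $\mathrm{Q}'$ be a quadric of $\mathrm{PG}(N,q)$ distinct from $\mathrm{Q}$, and let $V=\mathrm{Q}\cap\mathrm{Q}'$. If $$|V|>q^{N-2}+3q^{N-3}+3q^{N-4}+2q^{N-5}+\cdots+2q+1,$$ where the right-hand side is $q^{N-2}+3q^{N-3}+3q^{N-4}+\sum_{i=1}^{N-5}2q^{i}+1$ (so it equals $q^3+3q^2+3q+1$ for $N=5$), then the pencil of quadrics defined by $\mathrm{Q}$ and $\mathrm{Q}'$ contains a quadric consisting of two hyperplanes.
   Context: $\mathrm{PG}(N,q)$ is the $N$-dimensional projective space over $\mathbb{F}_q$. A quadric of $\mathrm{PG}(N,q)$ is given by a nonzero homogeneous quadratic polynomial $f(X_0,\ldots,X_N)$ over $\mathbb{F}_q$, up to nonzero scalar; it is identified with its set of $\mathbb{F}_q$-rational points $f=0$ when taking intersections and cardinalities. Two quadrics are distinct if their polynomials are not proportional. The non-singular quadrics are, up to projective equivalence: the parabolic quadric $\mathrm{Q}(2n,q)$ in $\mathrm{PG}(2n,q)$: $X_0^2+X_1X_2+\cdots+X_{2n-1}X_{2n}=0$; the hyperbolic quadric $\mathrm{Q}^+(2n+1,q)$ in $\mathrm{PG}(2n+1,q)$: $X_0X_1+\cdots+X_{2n}X_{2n+1}=0$; the elliptic quadric $\mathrm{Q}^-(2n+1,q)$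 in $\mathrm{PG}(2n+1,q)$: $g(X_0,X_1)+X_2X_3+\cdots+X_{2n}X_{2n+1}=0$ with $g$ an irreducible quadratic form over $\mathbb{F}_q$. If $\mathrm{Q}:f=0$ and $\mathrm{Q}':f'=0$, the pencil defined by $\mathrm{Q}$ and $\mathrm{Q}'$ is the set of the $q+1$ quadrics $\lambda f+\mu f'=0$, $(\lambda,\mu)\in\mathbb{F}_q^2\setminus\{(0,0)\}$ up to scalars. A quadric consisting of two hyperplanes is a quadric that is the union of two distinct hyperplanes of $\mathrm{PG}(N,q)$, i.e. its form is a product of two non-proportional linear forms over $\mathbb{F}_q$. *)

(* Defs.v *)
From mathcomp Require Import all_boot all_order all_algebra.
From mathcomp Require Export mpoly.

Set Implicit Arguments.
Unset Strict Implicit.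
Unset Printing Implicit Defensive.

Import GRing.Theory.
Local Open Scope ring_scope.

Section ProjectiveSpace.
Variables (F : finFieldType) (N : nat).

(* A point of PG(N,q) is a 1-dimensional subspace of F^(N+1), represented by
   the set of its vectors (the zero vector included). *)
Definition line_of (v : 'rV[F]_N.+1) : {set 'rV[F]_N.+1} :=
  [set a *: v | a : F].

Definition PG : {set {set 'rV[F]_N.+1}} :=
  [set line_of v | v : 'rV[F]_N.+1 & v != 0].

(* A quadric is handled through a representing form; forms that differ by a
   nonzero scalar represent the same quadric. *)
Definition is_quadric (f : {mpoly F[N.+1]}) : Prop :=
  f != 0 /\ f \is 2.-homog.

Definition proportional (f g : {mpoly F[N.+1]}) : Prop :=
  exists2 c : F, c != 0 & g = c *: f.

Definition points (f : {mpoly F[N.+1]}) : {set {set 'rV[F]_N.+1}} :=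
  [set P in PG | [forall v in P, f.@[fun i => v 0 i] == 0]].

Definition in_pencil (f f' h : {mpoly F[N.+1]}) : Prop :=
  exists l m : F, (l, m) != (0, 0) /\ h = l *: f + m *: f'.

Definition two_hyperplanes (h : {mpoly F[N.+1]}) : Prop :=
  exists l1 l2 : {mpoly F[N.+1]},
    [/\ l1 != 0 /\ l1 \is 1.-homog, l2 != 0 /\ l2 \is 1.-homog,
        ~ proportional l1 l2 & h = l1 * l2].

Definition linear_change (A : 'M[F]_N.+1) : (N.+1).-tuple {mpoly F[N.+1]} :=
  [tuple \sum_(j < N.+1) A i j *: 'X_j | i < N.+1].

Definition proj_equiv (f g : {mpoly F[N.+1]}) : Prop :=
  exists2 A : 'M[F]_N.+1, A \in unitmx &
    proportional f (g \mPo linear_change A).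

(* Coordinate X_k; only meaningful for k <= N, as inord truncates. *)
Definition coordX (k : nat) : {mpoly F[N.+1]} := 'X_(inord k).

(* Below N = 2n or N = 2n+1, so that n = N./2. *)
Definition parabolic_form : {mpoly F[N.+1]} :=
  coordX 0 ^+ 2 + \sum_(1 <= i < (N./2).+1) coordX (2 * i - 1) * coordX (2 * i).

Definition hyperbolic_form : {mpoly F[N.+1]} :=
  \sum_(0 <= i < (N./2).+1) coordX (2 * i) * coordX (2 * i + 1).

Definition elliptic_form (g : {mpoly F[2]}) : {mpoly F[N.+1]} :=
  g \mPo [tuple coordX 0; coordX 1]
  + \sum_(1 <= i < (N./2).+1) coordX (2 * i) * coordX (2 * i + 1).

Definition irreducible_mpoly (g : {mpoly F[2]}) : Prop :=
  [/\ g != 0, g \isn't a GRing.unit &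
      forall a b : {mpoly F[2]}, g = a * b ->
        a \is a GRing.unit \/ b \is a GRing.unit].

Definition is_parabolic (f : {mpoly F[N.+1]}) : Prop :=
  ~~ odd N /\ proj_equiv f parabolic_form.

Definition is_hyperbolic (f : {mpoly F[N.+1]}) : Prop :=
  odd N /\ proj_equiv f hyperbolic_form.

Definition is_elliptic (f : {mpoly F[N.+1]}) : Prop :=
  odd N /\ exists g : {mpoly F[2]},
    [/\ g \is 2.-homog, irreducible_mpoly g & proj_equiv f (elliptic_form g)].

Definition nonsingular (f : {mpoly F[N.+1]}) : Prop :=
  [\/ is_parabolic f, is_hyperbolic f | is_elliptic f].

End ProjectiveSpace.

(* Main.v *)
Require Import Defs.
From mathcomp Require Import all_boot all_order all_algebra.
From mathcomp Require Import ring zify.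

Set Implicit Arguments.
Unset Strict Implicit.
Unset Printing Implicit Defensive.

Import Order.TTheory GRing.Theory Num.Theory.
Local Open Scope ring_scope.

(** Every point of [V = Q :&: Q'] lies on all [q + 1] members of the pencil
    and every other point lies on exactly one, so a large [V] forces some
    member [h] to be large ([pencil_average]).  The size of a quadric is
    governed by how many hyperbolic planes its form splits off: splitting off
    one divides the excess [q * #zeros - #vectors] only by [q] while it divides
    the number of vectors by [q ^ 2] ([excess_perp], [card_perp]), and a
    nonzero form from which no plane splits off has as its zeros a proper
    subspace, so its excess is not positive ([pair_or_excess]).  Hence a form
    with a large excess is a sum of few products of linear forms
    ([hyperbolic_sum_or_bound]).  For the large member [h] this leaves two
    possibilities: a product of two linear forms, which is the conclusion
    sought, or [h = l1 * l2 + l3 * l4], a cone over a hyperbolic quadric of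
    PG(3,q).

    The cone is excluded.  A regulus of its base spans, with the vertex,
    [q + 1] subspaces of codimension 2 covering the cone ([ruling_cover]), so
    [V] is covered by the zeros of [f] on these subspaces.  On one of them the
    same excess argument shows that [f] has at most
    [q ^ (N - 3) + 2 * q ^ (N - 4) + q ^ (N - 5) + ... + 1] projective zeros,
    unless it vanishes there or is a product of two linear forms; in both
    exceptional cases [f] would vanish on a subspace of vector dimension
    [N - 2], which exceeds the Witt index of a non-singular form under the
    hypotheses on [N] ([nonsingular_bound]).  Adding up the [q + 1] bounds
    gives exactly the right-hand side of the hypothesis on [V]
    ([cone_bound], [bound_arith_cone]).

    Everything before the passage to polynomials is free of coordinates.  A
    subspace is a finite set of vectors and its dimension is read from its
    cardinality, so that the counting needs no bases. *)

(** * Subspaces of a finite vector space, counted by cardinality *)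
Section Subspaces.
Variables (F : finFieldType) (V : finLmodType F).
Implicit Types (U W : {set V}) (phi : V -> F).

Definition subspace U := GRing.submod_closed U.

Definition linear_form phi :=
  forall a u v, phi (a *: u + v) = a * phi u + phi v.

Definition kernel U phi := [set t in U | phi t == 0].

Lemma subspaceT : subspace [set: V].
Proof. by split=> [|a u v _ _]; rewrite inE. Qed.

Lemma subspace_comb U a u v :
  subspace U -> u \in U -> v \in U -> a *: u + v \in U.
Proof. by move=> [_ h]; apply: h. Qed.

Lemma subspaceZ U a u : subspace U -> u \in U -> a *: u \in U.
Proof.
by move=> hU hu; rewrite -[_ *: _]addr0; apply: subspace_comb; case: hU.
Qed.

Lemma subspaceD U u v : subspace U -> u \in U -> v \in U -> u + v \in U.
Proof. by rewrite -{2}[u]scale1r; apply: subspace_comb. Qed.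

Lemma subspaceB U u v : subspace U -> u \in U -> v \in U -> u - v \in U.
Proof.
by move=> hU hu hv; rewrite -scaleN1r; apply: subspaceD => //; apply: subspaceZ.
Qed.

Lemma linear_form0 phi : linear_form phi -> phi 0 = 0.
Proof. by move=> h; have := h (-1) 0 0; rewrite scaler0 addr0 mulN1r addNr. Qed.

Lemma linear_formZ phi a u : linear_form phi -> phi (a *: u) = a * phi u.
Proof.
by move=> h; have := h a u 0; rewrite addr0 (linear_form0 h) addr0.
Qed.

Lemma linear_formB phi u v : linear_form phi -> phi (u - v) = phi u - phi v.
Proof.
by move=> h; have := h (-1) v u; rewrite scaleN1r mulN1r addrC [RHS]addrC.
Qed.

Lemma kernel_subspace U phi :
  subspace U -> linear_form phi -> subspace (kernel U phi).
Proof.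
move=> hU hphi; split=> [|a u v].
  by rewrite !inE (linear_form0 hphi) eqxx andbT; case: hU.
rewrite !inE => /andP[hu /eqP u0] /andP[hv /eqP v0].
by rewrite hphi u0 v0 mulr0 addr0 eqxx subspace_comb.
Qed.

(** If [phi u0 != 0], a vector is determined by its value under [phi] and its
    projection to the kernel along [u0]. *)
Lemma card_kernel_ge U phi :
  subspace U -> linear_form phi -> (#|U| <= #|F| * #|kernel U phi|)%N.
Proof.
move=> hU hphi.
have [/existsP[u0 /andP[hu0 nz]]|/existsPn h] :=
    boolP [exists u in U, phi u != 0]; last first.
  have -> : kernel U phi = U.
    apply/setP=> u; rewrite inE; have := h u.
    by rewrite negb_and negbK; case: (u \in U).
  by rewrite leq_pmull //; apply/card_gt0P; exists 0.
pose g u := (phi u, u - (phi u / phi u0) *: u0).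
rewrite -cardsT -cardsX -(@card_in_imset _ _ g); last first.
  by move=> u v _ _ [-> /eqP]; rewrite subr_eq subrK => /eqP.
apply: subset_leq_card; apply/subsetP => _ /imsetP[u hu ->].
rewrite !inE /= subspaceB ?subspaceZ //= linear_formB // linear_formZ //.
by rewrite divfK // subrr.
Qed.

(** The translates of [W] by the multiples of a vector outside [W] are
    disjoint. *)
Lemma card_proper U W :
  subspace U -> subspace W -> W \proper U -> (#|F| * #|W| <= #|U|)%N.
Proof.
move=> hU hW /properP[sWU [t tU tW]].
pose g (p : F * V) := p.1 *: t + p.2.
rewrite -cardsT -cardsX -(@card_in_imset _ _ g).
  apply: subset_leq_card; apply/subsetP=> _ /imsetP[[a w] /setXP[_ /= hw] ->].
  by apply: subspace_comb => //; apply: (subsetP sWU).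
move=> [a w] [c x] /setXP[_ /= hw] /setXP[_ /= hx]; rewrite /g /= => e.
have e' : (a - c) *: t = x - w.
  by rewrite scalerBl; apply/eqP; rewrite subr_eq addrAC (addrC x) -e addrK.
have [ac|nac] := eqVneq a c; first by move: e; rewrite ac => /addrI ->.
case/negP: tW; rewrite -[t]scale1r -(@mulVf _ (a - c)) ?subr_eq0 //.
by rewrite -scalerA e'; apply: subspaceZ => //; apply: subspaceB.
Qed.

Lemma card_kernel U phi u :
    subspace U -> linear_form phi -> u \in U -> phi u != 0 ->
  #|U| = (#|F| * #|kernel U phi|)%N.
Proof.
move=> hU hphi uU nz; apply/eqP; rewrite eqn_leq card_kernel_ge //=.
apply: card_proper => //; first exact: kernel_subspace.
apply/properP; split; first by apply/subsetP=> x; rewrite inE => /andP[].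
by exists u => //; rewrite inE (negbTE nz) andbF.
Qed.

End Subspaces.

(** * Quadratic forms and hyperbolic pairs *)
Section QuadraticForms.
Variables (F : finFieldType) (V : finLmodType F).
Implicit Types (U W : {set V}) (Q : V -> F).

Definition polar Q u v := Q (u + v) - Q u - Q v.

Definition quadratic Q :=
  (forall a v, Q (a *: v) = a ^+ 2 * Q v) /\
  (forall w, linear_form (fun v => polar Q v w)).

Definition zeros Q U := [set t in U | Q t == 0].

Definition hyperbolic_pair Q U v w :=
  [/\ v \in U, w \in U, Q v = 0, Q w = 0 & polar Q v w = 1].

Definition perp Q U v w := kernel (kernel U (polar Q ^~ v)) (polar Q ^~ w).

(** For a form on a space of [q ^ n] vectors this is [q] times the deviation of
    the number of zeros from the [q ^ (n - 1)] zeros of a linear form; the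
    factor [q] avoids the exponent [n - 1]. *)
Definition excess Q U : int := #|F|%:Z * #|zeros Q U|%:Z - #|U|%:Z.

Lemma polarC Q u v : polar Q u v = polar Q v u.
Proof. by rewrite /polar (addrC u v) addrAC. Qed.

Variable Q : V -> F.
Hypothesis hQ : quadratic Q.
Local Notation b := (polar Q).

Lemma quadZ a v : Q (a *: v) = a ^+ 2 * Q v. Proof. by case: hQ. Qed.
Lemma polar_linear w : linear_form (b ^~ w). Proof. by case: hQ. Qed.

Lemma quad0 : Q 0 = 0.
Proof. by rewrite -(scale0r 0) quadZ expr0n mul0r. Qed.

Lemma quadD u v : Q (u + v) = Q u + Q v + b u v.
Proof. rewrite /polar; ring. Qed.

Lemma polarDl u v w : b (u + v) w = b u w + b v w.
Proof. by have := polar_linear w 1 u v; rewrite scale1r mul1r. Qed.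
Lemma polarDr u v w : b w (u + v) = b w u + b w v.
Proof. by rewrite !(polarC _ w) polarDl. Qed.
Lemma polarZl a u w : b (a *: u) w = a * b u w.
Proof. exact: (linear_formZ _ _ (polar_linear w)). Qed.
Lemma polarZr a u w : b w (a *: u) = a * b w u.
Proof. by rewrite !(polarC _ w) polarZl. Qed.

Lemma polar_singular v : Q v = 0 -> b v v = 0.
Proof.
move=> v0; rewrite /polar v0 -mulr2n -scaler_nat quadZ v0; ring.
Qed.

(** For a hyperbolic pair [v, w], the projection onto its orthogonal
    complement along the plane spanned by [v] and [w]. *)
Definition projection v w t := t - b t w *: v - b t v *: w.

Lemma projectionK v w t : b t w *: v + b t v *: w + projection v w t = t.
Proof. by rewrite /projection -(addrA t) -opprD addrCA subrr addr0. Qed.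

Lemma perpP U v w t :
  reflect [/\ t \in U, b t v = 0 & b t w = 0] (t \in perp Q U v w).
Proof.
rewrite !inE -andbA.
by apply: (iffP and3P) => [[-> /eqP -> /eqP ->]|[-> -> ->]].
Qed.

Lemma perp_subspace U v w : subspace U -> subspace (perp Q U v w).
Proof. by move=> hU; do 2![apply: kernel_subspace (polar_linear _)]. Qed.

Section Pair.
Variables (U : {set V}) (v w : V).
Hypotheses (hU : subspace U) (hvw : hyperbolic_pair Q U v w).

Lemma pair_coords a c z : z \in perp Q U v w ->
  [/\ b (a *: v + c *: w + z) w = a, b (a *: v + c *: w + z) v = c
    & Q (a *: v + c *: w + z) = a * c + Q z].
Proof.
case: hvw => _ _ v0 w0 vw /perpP[_ zv zw].
rewrite !polarDl !polarZl !quadD !polarDl !polarZl !quadZ polarZr v0 w0.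
rewrite !(polarC _ _ z) zv zw (polarC _ w v) vw !polar_singular //.
by split; ring.
Qed.

Lemma projection_perp t : t \in U -> projection v w t \in perp Q U v w.
Proof.
case: hvw => hv hw v0 w0 vw ht; apply/perpP; split.
- by rewrite !subspaceB ?subspaceZ.
- rewrite /projection -!scaleNr !polarDl !polarZl (polarC _ w v) vw.
  by rewrite !polar_singular //; ring.
- rewrite /projection -!scaleNr !polarDl !polarZl vw.
  by rewrite !polar_singular //; ring.
Qed.

(** The coefficients of [t] on the hyperbolic plane are its polar products
    with [w] and [v], so the two linear factors split off from [Q] are
    themselves values of the polar form. *)
Lemma quad_split t : t \in U -> Q t = b t w * b t v + Q (projection v w t).
Proof.
move=> ht; have hz := projection_perp ht.
by have [_ _] := pair_coords (b t w) (b t v) hz; rewrite projectionK.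
Qed.

Let glue (p : F * F * V) := p.1.1 *: v + p.1.2 *: w + p.2.

Lemma glue_inj : {in setX [set: F * F] (perp Q U v w) &, injective glue}.
Proof.
move=> [[a c] z] [[a' c'] z'] /setXP[_ /= hz] /setXP[_ /= hz'].
rewrite /glue /= => e.
have [e1 e2 _] := pair_coords a c hz; have [e3 e4 _] := pair_coords a' c' hz'.
have ea : a = a' by rewrite -e1 e e3.
have ec : c = c' by rewrite -e2 e e4.
by move: e; rewrite ea ec => /addrI ->.
Qed.

Lemma glue_in p : p.2 \in perp Q U v w -> glue p \in U.
Proof.
case: hvw => hv hw _ _ _; case: p => [[a c] z] /= /perpP[hz _ _].
by rewrite /glue -addrA !subspace_comb.
Qed.

Lemma card_perp : #|U| = (#|F| ^ 2 * #|perp Q U v w|)%N.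
Proof.
rewrite -mulnn -card_prod -cardsT -cardsX -(card_in_imset glue_inj).
congr #|pred_of_set _|; apply/setP=> t; apply/idP/imsetP => [ht|]; last first.
  by case=> [[p z] /setXP[_ hz] ->]; apply: glue_in.
exists (b t w, b t v, projection v w t); last by rewrite /glue projectionK.
by rewrite in_setX in_setT projection_perp.
Qed.

Lemma card_mul_eq (d : F) :
  #|[set p : F * F | p.1 * p.2 + d == 0]|
  = (#|F|.-1 + #|F| * (d == 0)%R)%N.
Proof.
rewrite -sum1dep_card (eq_bigl (fun p => xpredT p.1 && (p.1 * p.2 + d == 0))) //.
rewrite -(pair_big_dep xpredT (fun a c => a * c + d == 0) (fun _ _ => 1%N)) /=.
rewrite (bigD1 (0 : F)) //= addnC; congr addn.
  rewrite (eq_bigr (fun=> 1%N)).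
    by rewrite sum1_card cardC1.
  move=> a a0; rewrite sum1dep_card -(cards1 (- d / a)).
  apply: eq_card => c; rewrite !inE addr_eq0; apply/eqP/eqP => [<-|->].
    by rewrite mulrC mulKf.
  by rewrite mulrC divfK.
rewrite sum1dep_card (eq_card (B := fun=> d == 0)); last first.
  by move=> c; rewrite !inE mul0r add0r.
by case: (d == 0); rewrite ?muln1 ?muln0 ?card0 //.
Qed.

(** Over a vector [z] of the complement lie the solutions [(a, c)] of
    [a * c = - Q z]: there are [q - 1] of them, and [q] more if [Q z = 0]. *)
Lemma card_zeros_perp :
  #|zeros Q U| =
    (#|F| * #|zeros Q (perp Q U v w)| + #|F|.-1 * #|perp Q U v w|)%N.
Proof.
pose T := [set p : F * F * V |
             (p.2 \in perp Q U v w) && (p.1.1 * p.1.2 + Q p.2 == 0)].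
have -> : zeros Q U = glue @: T.
  apply/setP=> t; apply/idP/imsetP => [|[p]].
    rewrite in_set => /andP[ht /eqP t0].
    exists (b t w, b t v, projection v w t); last by rewrite /glue projectionK.
    by rewrite in_set projection_perp //= -quad_split // t0.
  rewrite in_set => /andP[hp e] ->; rewrite in_set glue_in //=.
  by case: p hp e => [[a c] z] /= hz; have [_ _ ->] := pair_coords a c hz.
rewrite card_in_imset; last first.
  move=> [? ?] [? ?]; rewrite [in X in X -> _]in_set => /andP[hp _].
  rewrite in_set => /andP[hp' _].
  by apply: glue_inj; rewrite in_setX in_setT.
rewrite -sum1dep_card.
rewrite (reindex (fun x : V * (F * F) => (x.2, x.1))) /=; last first.
  by exists (fun x => (x.2, x.1)) => [[? ?]|[? ?]].
rewrite -(pair_big_dep (fun z => z \in perp Q U v w)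
  (fun z (p : F * F) => p.1 * p.2 + Q z == 0) (fun _ _ => 1%N)) /=.
under eq_bigr do rewrite sum1dep_card card_mul_eq.
rewrite big_split /= sum_nat_const mulnC addnC; congr addn.
by rewrite -big_distrr /= -sum1dep_card big_mkcondr.
Qed.

(** The part of the zero count that is constant along the fibres cancels
    against the number of vectors. *)
Lemma excess_perp : excess Q U = #|F|%:Z * excess Q (perp Q U v w).
Proof.
rewrite /excess card_perp -mulnn card_zeros_perp.
have : (0 < #|F|)%N by apply/card_gt0P; exists 0.
case: #|F| => // q _ /=.
by rewrite -addn1 !(PoszD, PoszM); ring.
Qed.

End Pair.

(** A singular vector [v] with [b v w != 0] for some [w] gives a hyperbolic
    pair, after scaling [w] and making it singular by adding a multiple of
    [v].  If there is none, all singular vectors lie in the radical, on which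
    [Q] is additive, so they form a subspace. *)
Lemma pair_or_excess U : subspace U ->
  [\/ {in U, forall t, Q t = 0}, (excess Q U <= 0)%R
    | exists v w, hyperbolic_pair Q U v w].
Proof.
move=> hU.
have [/existsP[v /existsP[w /and4P[vU wU /eqP v0 nz]]]|/existsPn h] :=
  boolP [exists v, exists w, [&& v \in U, w \in U, Q v == 0 & b v w != 0]].
  constructor 3; pose x := (b v w)^-1 *: w.
  have vx : b v x = 1 by rewrite polarZr mulVf.
  have xU : x \in U by apply: subspaceZ.
  (* [Q (c * v + x) = c + Q x] since [b v x = 1] *)
  exists v, (- Q x *: v + x); split=> //; first exact: subspace_comb.
    by rewrite quadD quadZ v0 polarZl vx; ring.
  by rewrite polarDr polarZr vx polar_singular //; ring.
have rad v w : v \in U -> w \in U -> Q v = 0 -> b v w = 0.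
  move=> vU wU v0; have /existsPn/(_ w) := h v.
  by rewrite vU wU v0 eqxx /= negbK => /eqP.
have [/forallP all0|/forallPn[t]] := boolP [forall t in U, Q t == 0].
  by constructor 1 => t tU; apply/eqP; have := all0 t; rewrite tU.
rewrite negb_imply => /andP[tU t0]; constructor 2.
rewrite /excess subr_le0 -PoszM lez_nat; apply: card_proper => //.
  split=> [|a u v]; first by rewrite inE quad0 eqxx andbT; case: hU.
  rewrite !inE => /andP[uU /eqP u0] /andP[vU /eqP v0].
  rewrite subspace_comb // quadD quadZ u0 v0 polarZl rad //.
  by rewrite !mulr0 !addr0 eqxx.
apply/properP; split; first by apply/subsetP=> x; rewrite inE => /andP[].
by exists t => //; rewrite inE (negbTE t0) andbF.
Qed.

End QuadraticForms.

(** * Forms with many zeros are short sums of products *)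
Section Splitting.
Variables (F : finFieldType) (V : finLmodType F) (Q : V -> F).
Hypothesis hQ : quadratic Q.
Implicit Types U W : {set V}.
Local Notation b := (polar Q).
Local Notation q := #|F|.

(** Choosing each further pair in the complement of the previous ones makes the
    pairs mutually orthogonal, so that the linear factors polar to them are
    defined on all of [U] without reference to projections. *)
Fixpoint hyperbolic_sum k U : Prop :=
  {in U, forall t, Q t = 0} \/
  if k is k'.+1 then
    exists v w, hyperbolic_pair Q U v w /\ hyperbolic_sum k' (perp Q U v w)
  else False.

Lemma excess_le U : (excess Q U <= (q%:Z - 1) * #|U|%:Z)%R.
Proof.
rewrite /excess mulrBl mul1r lerB // ler_wpM2l // lez_nat subset_leq_card //.
by apply/subsetP=> t; rewrite inE => /andP[].
Qed.

Lemma card_field_gt1 : (1 < q)%N.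
Proof. exact: card_finNzRing_gt1. Qed.

(** The excess of [U] is [q] times that of the complement of a plane splitting
    off, while [#|U|] is [q ^ 2] times the size of the complement.  If [k + 1]
    planes split off, the trivial bound [excess_le] for the last complement is
    multiplied back up; if fewer do, the last complement carries either the
    zero form or a form of nonpositive excess. *)
Lemma hyperbolic_sum_or_bound k U : subspace U ->
  hyperbolic_sum k U \/
  (q%:Z ^+ k.+1 * excess Q U <= (q%:Z - 1) * #|U|%:Z)%R.
Proof.
have q0 : (0 <= q%:Z - 1 :> int)%R by have := card_field_gt1; lia.
elim: k U => [|k IH] U hU; case: (pair_or_excess hQ hU) => [h|h|[v [w hvw]]].
- by left; left.
- right; apply: (@le_trans _ _ 0); last by rewrite mulr_ge0.
  by rewrite mulr_ge0_le0 // exprn_ge0.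
- right; rewrite (excess_perp hQ hU hvw) (card_perp hQ hU hvw) PoszM expr1.
  rewrite mulrA -PoszM mulnn mulrCA ler_wpM2l //; exact: excess_le.
- by left; left.
- right; apply: (@le_trans _ _ 0); last by rewrite mulr_ge0.
  by rewrite mulr_ge0_le0 // exprn_ge0.
case: (IH _ (perp_subspace hQ v w hU)) => h; first by left; right; exists v, w.
right; rewrite (excess_perp hQ hU hvw) (card_perp hQ hU hvw) PoszM exprSr.
rewrite mulrCA -!mulrA mulrCA (mulrA (Posz q)) -PoszM mulnn.
by rewrite mulrCA [leRHS]mulrCA ler_wpM2l.
Qed.

(** A form that is zero or a product of two linear forms vanishes on a
    hyperplane. *)
Lemma hyperbolic_sum1_singular U : subspace U -> hyperbolic_sum 1 U ->
  exists W, [/\ subspace W, W \subset U, {in W, forall t, Q t = 0}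
              & (#|U| <= q * #|W|)%N].
Proof.
move=> hU [h|[v [w [hvw [h|//]]]]].
  exists U; split=> //; rewrite leq_pmull //; exact: ltnW card_field_gt1.
exists (kernel U (b ^~ v)); split.
- exact: kernel_subspace (polar_linear hQ v).
- by apply/subsetP=> t; rewrite inE => /andP[].
- move=> t; rewrite inE => /andP[ht /eqP tv].
  by rewrite (quad_split hQ hU hvw ht) tv h ?mulr0 ?addr0 // projection_perp.
- exact: card_kernel_ge (polar_linear hQ v).
Qed.

(** * The codimension 2 subspaces on a cone over a hyperbolic quadric *)

(** On [U], [Q] is [l1 * l2 + l4 * l3] with [l1 = b _ w1], [l2 = b _ v1],
    [l3 = b _ v2] and [l4 = b _ w2]. *)
Section Ruling.
Variables (U : {set V}) (v1 w1 v2 w2 : V).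
Hypotheses (hU : subspace U) (h1 : hyperbolic_pair Q U v1 w1)
  (h2 : hyperbolic_pair Q (perp Q U v1 w1) v2 w2)
  (h0 : {in perp Q (perp Q U v1 w1) v2 w2, forall t, Q t = 0}).

(** One regulus: [l1 = s * l3] and [l4 = - s * l2] for a scalar [s], together
    with [l3 = l2 = 0] for the parameter at infinity. *)
Definition ruling (s : option F) : {set V} :=
  if s is Some s then
    kernel (kernel U (fun t => b t w1 - s * b t v2))
           (fun t => b t w2 + s * b t v1)
  else kernel (kernel U (b ^~ v2)) (b ^~ v1).

Lemma two_pairs_split t : t \in U -> Q t = b t w1 * b t v1 + b t w2 * b t v2.
Proof.
move=> tU; have tP := projection_perp hQ hU h1 tU.
have hP := perp_subspace hQ v1 w1 hU.
rewrite (quad_split hQ hU h1 tU) (quad_split hQ hP h2 tP) h0 ?projection_perp //.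
case: h2 => /perpP[_ e1 e2] /perpP[_ e3 e4] _ _ _.
congr (_ + _); rewrite /projection -!scaleNr !polarDl // !polarZl //.
rewrite !(polarC _ v1) !(polarC _ w1) e1 e2 e3 e4; ring.
Qed.

Lemma ruling_linear1 s : linear_form (fun t => b t w1 - s * b t v2).
Proof. by move=> a u v; rewrite !polarDl // !polarZl //; ring. Qed.

Lemma ruling_linear2 s : linear_form (fun t => b t w2 + s * b t v1).
Proof. by move=> a u v; rewrite !polarDl // !polarZl //; ring. Qed.

Lemma ruling_subspace s : subspace (ruling s).
Proof.
case: s => [s|] /=.
  apply: kernel_subspace (ruling_linear2 s).
  exact: kernel_subspace (ruling_linear1 s).
by do 2![apply: kernel_subspace (polar_linear hQ _)].
Qed.

Lemma card_ruling s : #|U| = (q ^ 2 * #|ruling s|)%N.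
Proof.
case: h1 => v1U w1U Qv1 Qw1 vw1.
case: h2 => /perpP[v2U e1 e2] /perpP[w2U e3 e4] Qv2 Qw2 vw2.
have v22 := polar_singular hQ Qv2.
rewrite -mulnn -mulnA; case: s => [s|] /=.
  have hk := kernel_subspace hU (ruling_linear1 s).
  rewrite -(card_kernel hk (ruling_linear2 s) (u := v2)).
  - apply: (card_kernel hU (ruling_linear1 s) v1U).
    by rewrite vw1 polarC e1 mulr0 subr0 oner_eq0.
  - by rewrite inE v2U e2 v22 mulr0 subr0 eqxx.
  - by rewrite vw2 e1 mulr0 addr0 oner_eq0.
have hk := kernel_subspace hU (polar_linear hQ v2).
rewrite -(card_kernel hk (polar_linear hQ v1) (u := w1)).
- by apply: (card_kernel hU (polar_linear hQ v2) w2U); rewrite polarC vw2 oner_eq0.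
- by rewrite inE w1U polarC e2 eqxx.
- by rewrite polarC vw1 oner_eq0.
Qed.

Lemma ruling_cover t : t \in U -> Q t = 0 -> exists s, t \in ruling s.
Proof.
move=> tU; rewrite two_pairs_split // => e.
have [l3|l3] := eqVneq (b t v2) 0; last first.
  exists (Some (b t w1 / b t v2)); rewrite !inE tU divfK // subrr eqxx /=.
  apply/eqP/(mulIf l3); rewrite mul0r -[RHS]e; field.
  exact: l3.
move: e; rewrite l3 mulr0 addr0.
have [l2|l2] := eqVneq (b t v1) 0; first by exists None; rewrite !inE tU l3 l2 eqxx.
move/eqP; rewrite mulf_eq0 (negbTE l2) orbF => /eqP l1.
exists (Some (- b t w2 / b t v1)).
by rewrite !inE tU l1 l3 mulr0 subrr divfK // subrr eqxx.
Qed.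
End Ruling.
End Splitting.

(** * Counting the zeros of a pencil and of a section of a cone *)
Section Counting.
Variables (F : finFieldType) (V : finLmodType F).
Implicit Types (U W : {set V}) (Q : V -> F).
Local Notation q := #|F|.

Definition common Q Q' := [set t | (Q t == 0) && (Q' t == 0)].

(** The members of the pencil are given as a family equal pointwise to the
    linear combinations, so that it can be instantiated by evaluations of
    polynomials. *)
Definition is_pencil Q Q' (R : F * F -> V -> F) :=
  forall p t, R p t = p.1 * Q t + p.2 * Q' t.

Lemma quadraticD Q Q' : quadratic Q -> quadratic Q' ->
  quadratic (fun t => Q t + Q' t).
Proof.
move=> [h1 h2] [h3 h4]; split=> [a v|w a u v]; first by rewrite h1 h3 mulrDr.
have := congr2 +%R (h2 w a u v) (h4 w a u v); rewrite /polar => e.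
transitivity (Q (a *: u + v + w) - Q (a *: u + v) - Q w
  + (Q' (a *: u + v + w) - Q' (a *: u + v) - Q' w)); first by ring.
by rewrite e; ring.
Qed.

Lemma quadraticZ c Q : quadratic Q -> quadratic (fun t => c * Q t).
Proof.
move=> [h1 h2]; split=> [a v|w a u v]; first by rewrite h1 mulrCA.
have := congr1 ( *%R c) (h2 w a u v); rewrite /polar => e.
transitivity (c * (Q (a *: u + v + w) - Q (a *: u + v) - Q w)); first by ring.
by rewrite e; ring.
Qed.

Lemma card_line_eq (x y : F) :
  #|[set p : F * F | p.1 * x + p.2 * y == 0]|
  = if (x == 0) && (y == 0) then (q * q)%N else q.
Proof.
have [->|x0] /= := eqVneq x 0; have [->|y0] /= := eqVneq y 0.
- rewrite -card_prod; apply: eq_card => p; rewrite !inE !mulr0 addr0 eqxx.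
  by [].
- rewrite -[RHS](card_imset (mem F) (f := fun l => (l, 0 : F))) => [|? ? []//].
  apply: eq_card => -[l m]; rewrite !inE mulr0 add0r mulf_eq0 (negbTE y0) orbF /=.
  by apply/eqP/imsetP => [->|[? _ [_ ->]]//]; exists l.
- rewrite -[RHS](card_imset (mem F) (f := fun m => (0 : F, m))) => [|? ? []//].
  apply: eq_card => -[l m]; rewrite !inE mulr0 addr0 mulf_eq0 (negbTE x0) orbF /=.
  by apply/eqP/imsetP => [->|[? _ [-> _]]//]; exists m.
- rewrite -[RHS](card_imset (mem F) (f := fun m => (- (m * y) / x, m))) => [|? ? []//].
  apply: eq_card => -[l m]; rewrite !inE /= addr_eq0.
  apply/eqP/imsetP => [e|[? _ [-> ->]]]; last by rewrite divfK.
  by exists m; rewrite // -e mulfK.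
Qed.

(** A common zero of [Q] and [Q'] is a zero of all [q ^ 2] combinations, any
    other vector only of the [q] combinations on a line. *)
Lemma pencil_sum Q Q' R : is_pencil Q Q' R ->
  (\sum_p #|zeros (R p) [set: V]| =
   q ^ 2 * #|common Q Q'| + q * (#|[set: V]| - #|common Q Q'|))%N.
Proof.
move=> hR; transitivity
  (\sum_(t : V) #|[set p : F * F | (p.1 * Q t + p.2 * Q' t == 0)%R]|)%N.
  under eq_bigr do rewrite -sum1dep_card.
  under [RHS]eq_bigr do rewrite -sum1dep_card.
  rewrite (exchange_big_dep predT) //=; apply: eq_bigr => t _.
  by apply: eq_bigl => p; rewrite !inE hR.
under eq_bigr do rewrite card_line_eq.
rewrite (bigID (mem (common Q Q'))) /=; congr addn.
  rewrite [RHS]mulnC -[RHS]sum_nat_const; apply: eq_bigr => t; rewrite inE => ->.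
  by rewrite mulnn.
rewrite cardsT -(cardsC (common Q Q')) addKn [RHS]mulnC -[RHS]sum_nat_const.
apply: eq_big => t.
  by rewrite !inE.
by rewrite inE => /negbTE ->.
Qed.

Lemma pencil_average_arith (x S a v : nat) : (1 < x)%N -> (a <= v)%N ->
    (x ^ 4 * S + (x * x).-1 * v <= (x * x).-1 * ((x ^ 3 + x) * v))%N ->
    (v + S = x ^ 2 * a + x * (v - a))%N ->
  (x ^ 5 * a + v <= (x ^ 3 + x ^ 2) * v)%N.
Proof.
move=> x1 av h e.
have [y ey] : exists y, x = y.+2 by exists x.-2; lia.
have [w ew] : exists w, (v = a + w)%N by exists (v - a)%N; lia.
subst x v; rewrite -(leq_pmul2l (ltn0Sn y)).
have e2 : (y.+2 * y.+2).-1 = (y * y + 4 * y + 3)%N by lia.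
have e4 : (S = (y * y + 4 * y + 3) * a + (y + 1) * w)%N by lia.
rewrite e2 e4 in h; lia.
Qed.

(** If the [q ^ 2 - 1] nonzero combinations all obeyed the bound for forms
    that are not sums of two products, their total would bound the number of
    common zeros. *)
Lemma pencil_average Q Q' R : is_pencil Q Q' R -> (forall p, quadratic (R p)) ->
  (exists2 p, p != (0, 0) & hyperbolic_sum (R p) 2 [set: V]) \/
  (q ^ 5 * #|common Q Q'| + #|V| <= (q ^ 3 + q ^ 2) * #|V|)%N.
Proof.
move=> hR hquad; have q1 := card_field_gt1 F.
have [/forallP h|/forallPn[p]] := boolP [forall p, (p != (0, 0)) ==>
  (q ^ 4 * #|zeros (R p) [set: V]| + #|V| <= (q ^ 3 + q) * #|V|)%N];
  last first.
  rewrite negb_imply => /andP[p0 /negP hp]; left; exists p => //.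
  case: (hyperbolic_sum_or_bound (hquad p) 2 (subspaceT V)) => // hle; case: hp.
  move: hle; rewrite /excess cardsT.
  by move: (#|zeros _ _|) (#|V|) (#|F|) => z v x; lia.
have hb p : p != (0, 0) ->
  (q ^ 4 * #|zeros (R p) [set: V]| + #|V| <= (q ^ 3 + q) * #|V|)%N.
  exact: implyP (h p).
right.
have hsum : (\sum_(p : F * F | p != (0, 0)%R)
   (q ^ 4 * #|zeros (R p) [set: V]| + #|V|) <=
   \sum_(p : F * F | p != (0, 0)%R) (q ^ 3 + q) * #|V|)%N.
  exact: leq_sum.
have htot := pencil_sum hR.
rewrite (bigD1 (0, 0)) //= cardsT in htot.
rewrite big_split /= -big_distrr /= !sum_nat_const cardC1 card_prod in hsum.
apply: pencil_average_arith (max_card _) hsum _ => //; rewrite -htot.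
congr addn; rewrite -cardsT; congr #|pred_of_set _|; apply/setP=> t.
by rewrite !inE hR !mul0r addr0 eqxx.
Qed.

Lemma card_bigcup_le (I T : finType) (A : I -> {set T}) :
  (#|\bigcup_i A i| <= \sum_i #|A i|)%N.
Proof.
elim/big_rec2: _ => [|i n S _ h]; first by rewrite cards0.
by apply: leq_trans (leq_card_setU _ _) _; rewrite leq_add2l.
Qed.

Lemma cone_arith (x z u : nat) :
    (x%:Z ^+ 2 * (x%:Z * (1 + z)%N%:Z - u%:Z) <= (x%:Z - 1) * u%:Z)%R ->
  (x ^ 5 * z + (x ^ 5 + x ^ 2 * u) <= (x ^ 2 + x) * (x ^ 2 * u))%N.
Proof.
move=> h; have h' : (x ^ 3 * z + x ^ 3 + u <= (x ^ 2 + x) * u)%N by lia.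
by have := leq_mul (leqnn (x ^ 2)) h'; lia.
Qed.

(** The bound on [W] excludes the exceptional case of
    [hyperbolic_sum_or_bound] on each member of the ruling, which has
    codimension 2 while the exceptional case costs one more dimension.  The
    zero vector lies on every member and is removed before adding up. *)
Lemma cone_bound Q H v1 w1 v2 w2 : quadratic Q -> quadratic H ->
    (forall W, subspace W -> {in W, forall t, Q t = 0} ->
       (q ^ 3 * #|W| < #|V|)%N) ->
    hyperbolic_pair H [set: V] v1 w1 ->
    hyperbolic_pair H (perp H [set: V] v1 w1) v2 w2 ->
    {in perp H (perp H [set: V] v1 w1) v2 w2, forall t, H t = 0} ->
  (q ^ 5 * #|common Q H :\ 0%R| + q.+1 * (q ^ 5 + #|V|) <=
   q.+1 * ((q ^ 2 + q) * #|V|))%N.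
Proof.
move=> hQ hH hW h1 h2 h0; have q1 := card_field_gt1 F.
pose R s := ruling H [set: V] v1 w1 v2 w2 s.
have hR s : subspace (R s).
  exact (ruling_subspace hH v1 w1 v2 w2 (subspaceT V) s).
have cR s : #|V| = (q ^ 2 * #|R s|)%N.
  by rewrite -cardsT; exact (card_ruling hH (subspaceT V) h1 h2 s).
have hb s : (q ^ 5 * #|zeros Q (R s) :\ 0%R| + (q ^ 5 + #|V|)
             <= (q ^ 2 + q) * #|V|)%N.
  have z0 : 0 \in zeros Q (R s).
    by rewrite inE (quad0 hQ) eqxx andbT; case: (hR s).
  have := cardsD1 0 (zeros Q (R s)); rewrite z0 add1n => cz.
  case: (hyperbolic_sum_or_bound hQ 1 (hR s)) => [|hle].
    case/(hyperbolic_sum1_singular hQ (hR s)) => W [sW _ /(hW _ sW) hlt hle].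
    have := leq_mul (leqnn (q ^ 2)) hle.
    by rewrite mulnA -expnSr -cR leqNgt hlt.
  rewrite /excess cz in hle; rewrite (cR s); exact: cone_arith hle.
have sub : common Q H :\ 0%R \subset \bigcup_s (zeros Q (R s) :\ 0%R).
  apply/subsetP=> t; rewrite !inE => /and3P[t0 Qt /eqP Ht].
  have [s hs] := ruling_cover hH (subspaceT V) h1 h2 h0 (in_setT t) Ht.
  by apply/bigcupP; exists s; rewrite // !inE t0 Qt andbT.
have le1 := leq_trans (subset_leq_card sub) (card_bigcup_le _).
have : (\sum_(s : option F) (q ^ 5 * #|zeros Q (R s) :\ 0%R| + (q ^ 5 + #|V|))
     <= \sum_(s : option F) (q ^ 2 + q) * #|V|)%N by exact: leq_sum.
rewrite big_split -big_distrr /= !sum_nat_const card_option; apply: leq_trans.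
by rewrite leq_add2r leq_mul2l le1 orbT.
Qed.

End Counting.

(** * Totally singular subspaces *)
Section Witt.
Variables (F : finFieldType) (V : finLmodType F) (Q : V -> F).
Hypothesis hQ : quadratic Q.
Implicit Types U W : {set V}.
Local Notation b := (polar Q).
Local Notation q := #|F|.

Definition singular_bound U M :=
  forall W, subspace W -> W \subset U -> {in W, forall t, Q t = 0} ->
  (#|W| <= M)%N.

Lemma singular_polar W u v : subspace W -> {in W, forall t, Q t = 0} ->
  u \in W -> v \in W -> b u v = 0.
Proof.
by move=> hW h0 hu hv; rewrite /polar !h0 ?subspaceD // !subr0.
Qed.

Lemma projection_linear v w a t u :
  projection Q v w (a *: t + u) = a *: projection Q v w t + projection Q v w u.
Proof.
rewrite /projection !polarDl // !polarZl // !scalerBr.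
rewrite [(a * _ + _) *: v]scalerDl [(a * _ + _) *: w]scalerDl !scalerA.
by rewrite !opprD (addrACA (a *: t)) (addrACA (a *: t - _)).
Qed.

Lemma projection_subspace W v w : subspace W -> subspace (projection Q v w @: W).
Proof.
move=> hW; split=> [|a _ _ /imsetP[t ht ->] /imsetP[u hu ->]].
  apply/imsetP; exists 0; first by case: hW.
  have b0 x : b 0 x = 0 by exact: linear_form0 (polar_linear hQ x).
  by rewrite /projection !b0 !scale0r !subr0.
by rewrite -projection_linear imset_f // subspace_comb.
Qed.

(** A hyperbolic pair [v, w] raises the Witt index by at most one.  Let [W] be
    totally singular.  Projection along the plane of [v] and [w] maps the part
    of [W] orthogonal to [v] to a totally singular set of the complement.  If
    [v \in W], that part is all of [W] and the projection has a kernel of size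
    [q]; otherwise it has index at most [q] in [W] and the projection is
    injective on it. *)
Lemma singular_bound_hyperbolic U v w M : subspace U -> hyperbolic_pair Q U v w ->
  singular_bound (perp Q U v w) M -> singular_bound U (q * M).
Proof.
move=> hU hvw hM W hW sWU W0.
have [hv hw v0 w0 vw] := hvw.
pose p := projection Q v w.
have bound W' : subspace W' -> W' \subset W -> {in W', forall t, b t v = 0} ->
    (#|p @: W'| <= M)%N.
  move=> hW' sW' h'; apply: hM.
  - exact: projection_subspace.
  - apply/subsetP=> _ /imsetP[t ht ->]; apply: projection_perp => //.
    exact: (subsetP sWU _ (subsetP sW' _ ht)).
  - move=> _ /imsetP[t ht ->].
    have tW := subsetP sW' _ ht.
    have := quad_split hQ hU hvw (subsetP sWU _ tW).
    by rewrite h' // mulr0 add0r W0.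
have pE t : b t v = 0 -> p t = t - b t w *: v.
  by move=> e; rewrite /p /projection e scale0r subr0.
have [vW|vW] := boolP (v \in W).
  have Wv : {in W, forall t, b t v = 0} by move=> t tW; apply: singular_polar vW.
  pose g (t : V) := (b t w, p t).
  rewrite -(card_in_imset (f := g) (D := W)); last first.
    move=> t u tW uW [e1]; rewrite !pE ?Wv // e1 => /eqP.
    by rewrite subr_eq subrK => /eqP.
  apply: leq_trans (_ : #|setX [set: F] (p @: W)| <= _)%N; last first.
    by rewrite cardsX cardsT leq_mul2l bound ?orbT.
  apply: subset_leq_card; apply/subsetP=> _ /imsetP[t tW ->].
  by rewrite in_setX in_setT imset_f.
have hK := kernel_subspace hW (polar_linear hQ v).
apply: leq_trans (card_kernel_ge hW (polar_linear hQ v)) _.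
rewrite leq_mul2l -(card_in_imset (f := p) (D := kernel W (b ^~ v))).
  rewrite bound ?orbT //.
  - by apply/subsetP=> t; rewrite inE => /andP[].
  - by move=> t; rewrite inE => /andP[_ /eqP].
move=> t u; rewrite !inE => /andP[tW /eqP tv] /andP[uW /eqP uv].
rewrite !pE // => e.
have e' : (b t w - b u w) *: v = t - u.
  rewrite -{2}(subrK (b t w *: v) t) e -(addrA u) [RHS]addrC addKr.
  by rewrite scalerBl addrC.
have [exy|nexy] := eqVneq (b t w - b u w) 0.
  by apply/eqP; rewrite -subr_eq0 -e' exy scale0r.
case/negP: vW; rewrite -[v]scale1r -(mulVf nexy) -scalerA e'.
by apply: subspaceZ => //; apply: subspaceB.
Qed.
End Witt.

(** * Closure properties of quadratic forms *)
Section QuadraticClosure.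
Variables (F : finFieldType) (V : finLmodType F).
Implicit Types Q : V -> F.

Lemma quadratic_ext Q Q' : Q =1 Q' -> quadratic Q -> quadratic Q'.
Proof.
move=> e [h1 h2]; split=> [a v|w a u v]; rewrite /polar -!e.
  exact: h1.
exact: h2.
Qed.

Lemma quadraticM (phi psi : V -> F) : linear_form phi -> linear_form psi ->
  quadratic (fun t => phi t * psi t).
Proof.
move=> h1 h2; split=> [a v|w a u v]; first by rewrite !linear_formZ //; ring.
have D (g : V -> F) x y : linear_form g -> g (x + y) = g x + g y.
  by move=> h; rewrite -{1}[x]scale1r h mul1r.
by rewrite /polar !(D phi, D psi) ?linear_formZ //; ring.
Qed.

Lemma quadratic0 : quadratic (fun _ : V => 0 : F).
Proof.
by split=> [a v|w a u v]; rewrite /polar ?mulr0 // !subr0 mulr0 addr0.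
Qed.

Lemma quadratic_sum (I : Type) (r : seq I) (Q : I -> V -> F) :
  (forall i, quadratic (Q i)) -> quadratic (fun t => \sum_(i <- r) Q i t).
Proof.
move=> h; elim: r => [|i r IH].
  by apply: quadratic_ext quadratic0 => t; rewrite big_nil.
by apply: quadratic_ext (quadraticD (h i) IH) => t; rewrite big_cons.
Qed.

Lemma quadratic_comp (V' : finLmodType F) (Q : V -> F) (L : V' -> V) :
  (forall a u v, L (a *: u + v) = a *: L u + L v) ->
  quadratic Q -> quadratic (Q \o L).
Proof.
move=> hL [h1 h2]; have L0 : L 0 = 0.
  by have := hL (-1) 0 0; rewrite scaler0 addr0 scaleN1r addNr.
have LZ a v : L (a *: v) = a *: L v by rewrite -[a *: v]addr0 hL L0 addr0.
have LD u v : L (u + v) = L u + L v by rewrite -{1}[u]scale1r hL scale1r.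
split=> [a v|w a u v] /=; first by rewrite LZ.
by have := h2 (L w) a (L u) (L v); rewrite /polar /= !LD LZ.
Qed.
End QuadraticClosure.

(** * Homogeneous quadratic polynomials as quadratic forms *)
Section Polynomials.
Variables (F : finFieldType) (n : nat).
Implicit Types (f : {mpoly F[n]}) (v : 'rV[F]_n).

Definition eval_form f v : F := f.@[fun i => v 0 i].

Lemma entry_linear_form (i : 'I_n) : linear_form (fun v : 'rV[F]_n => v 0 i).
Proof. by move=> a u v; rewrite !mxE. Qed.

Lemma mdeg2P (m : 'X_{1..n}) : mdeg m = 2%N ->
  exists i j : 'I_n, (i <= j)%N /\ m = (U_(i) + U_(j))%MM.
Proof.
move=> m2; have [i im] : exists i, m i != 0%N.
  apply/existsP; rewrite -negb_forall; apply/negP => /forallP h.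
  by move: m2; rewrite mdegE big1 // => i _; apply/eqP.
have em : (m - U_(i) + U_(i))%MM = m by apply: submK; rewrite lep1mP.
have : mdeg (m - U_(i))%MM == 1%N.
  by have := congr1 mdeg em; rewrite mdegD mdeg1; lia.
case/mdeg1P=> j /eqP ej; rewrite ej in em.
have [ij|ji] := leqP i j; first by exists i, j; rewrite addmC.
by exists j, i; split; first exact: ltnW.
Qed.

(** Taking the coefficients upper triangular makes them unique, which is what
    [dhomog2_eq0] relies on. *)
Lemma dhomog2E f : f \is 2.-homog -> exists c : 'I_n -> 'I_n -> F,
  (forall i j : 'I_n, (j < i)%N -> c i j = 0) /\
  f = \sum_i \sum_j c i j *: ('X_i * 'X_j).
Proof.
move=> /dhomogP hf.
pose P g := exists c : 'I_n -> 'I_n -> F,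
  (forall i j : 'I_n, (j < i)%N -> c i j = 0) /\
  g = \sum_i \sum_j c i j *: ('X_i * 'X_j) :> {mpoly F[n]}.
suff : P (\sum_(m <- msupp f) f@_m *: 'X_[m]) by rewrite -mpolyE.
rewrite big_seq; apply: (big_ind P).
- exists (fun _ _ => 0); split=> //.
  by rewrite big1 // => i _; rewrite big1 // => j _; rewrite scale0r.
- move=> _ _ [c [hc ->]] [d [hd ->]]; exists (fun i j => c i j + d i j); split.
    by move=> i j ij; rewrite hc ?hd ?addr0.
  rewrite -big_split; apply: eq_bigr => i _; rewrite -big_split.
  by apply: eq_bigr => j _; rewrite scalerDl.
move=> m /hf /mdeg2P[a [b [ab ->]]].
set x := f@_ _; exists (fun i j => if (i == a) && (j == b) then x else 0).
split=> [i j ji|].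
  by case: ifP => // /andP[/eqP ei /eqP ej]; move: ji; rewrite ei ej ltnNge ab.
rewrite (bigD1 a) //= [X in _ + X]big1 ?addr0 => [|i ia]; last first.
  by rewrite big1 // => j _; rewrite (negbTE ia) scale0r.
rewrite (bigD1 b) //= big1 ?addr0 => [|j jb]; last first.
  by rewrite (negbTE jb) andbF scale0r.
by rewrite !eqxx mpolyXD.
Qed.

Lemma eval_sum2 (c : 'I_n -> 'I_n -> F) v :
  eval_form (\sum_i \sum_j c i j *: ('X_i * 'X_j)) v
  = \sum_i \sum_j c i j * (v 0 i * v 0 j).
Proof.
rewrite /eval_form raddf_sum; apply: eq_bigr => i _; rewrite raddf_sum.
by apply: eq_bigr => j _; rewrite /= mevalZ mevalM !mevalXU.
Qed.

Lemma quadratic_eval f : f \is 2.-homog -> quadratic (eval_form f).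
Proof.
move=> /dhomog2E[c [_ ->]].
apply: quadratic_ext (fun v => esym (eval_sum2 c v)) _.
do 2![apply: quadratic_sum => ?]; apply: quadraticZ; apply: quadraticM;
  exact: entry_linear_form.
Qed.

(** This holds even over the field with two elements, where a quadratic
    polynomial has degree as large as the field: the coefficients are
    recovered from the values at the basis vectors and at their pairwise
    sums. *)
Lemma dhomog2_eq0 f : f \is 2.-homog -> (forall v, eval_form f v = 0) -> f = 0.
Proof.
move=> hf f0; have [c [hc ef]] := dhomog2E hf.
pose S (u w : 'rV[F]_n) := \sum_i \sum_j c i j * (u 0 i * w 0 j).
have S0 v : S v v = 0 by rewrite -(f0 v) ef eval_sum2.
have SD u v : S (u + v) (u + v) = S u u + S u v + (S v u + S v v).
  rewrite /S -!big_split; apply: eq_bigr => i _; rewrite -!big_split.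
  by apply: eq_bigr => j _; rewrite !mxE /=; ring.
pose e i : 'rV[F]_n := delta_mx 0 i.
have Se a b : S (e a) (e b) = c a b.
  rewrite /S (bigD1 a) //= [X in _ + X]big1 ?addr0 => [|i ia]; last first.
    by rewrite big1 // => j _; rewrite !mxE (negbTE ia) andbF mul0r mulr0.
  rewrite (bigD1 b) //= big1 ?addr0 => [|j jb]; last first.
    by rewrite !mxE (negbTE jb) andbF mulr0 mulr0.
  by rewrite !mxE !eqxx !mulr1.
rewrite ef big1 // => i _; rewrite big1 // => j _.
suff -> : c i j = 0 by rewrite scale0r.
(* Triangularity turns the polar value [c i j + c j i] into [c i j]. *)
have [ij|ji|/val_inj <-] := ltngtP i j.
- have := SD (e i) (e j); rewrite !S0 !Se (hc j i) // !addr0 add0r.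
  by move/esym.
- exact: hc.
- by rewrite -Se.
Qed.

Definition linear_mpoly (phi : 'rV[F]_n -> F) : {mpoly F[n]} :=
  \sum_j phi (delta_mx 0 j) *: 'X_j.

Lemma linear_mpoly_homog phi : linear_mpoly phi \is 1.-homog.
Proof. by apply: rpred_sum => j _; apply: rpredZ; rewrite dhomogX /= mdeg1. Qed.

Lemma eval_linear_mpoly phi v :
  linear_form phi -> eval_form (linear_mpoly phi) v = phi v.
Proof.
move=> h; rewrite /eval_form raddf_sum {2}(row_sum_delta v).
have -> : phi (\sum_j v 0 j *: delta_mx 0 j) = \sum_j v 0 j * phi (delta_mx 0 j).
  elim/big_rec2: _ => [|j x y _ <-]; [exact: linear_form0|exact: h].
by apply: eq_bigr => j _; rewrite /= mevalZ mevalXU mulrC.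
Qed.

Lemma eval_pencil f f' p v :
  eval_form (p.1 *: f + p.2 *: f') v = p.1 * eval_form f v + p.2 * eval_form f' v.
Proof. by rewrite /eval_form mevalD !mevalZ. Qed.

End Polynomials.

(** * The Witt index of the standard forms *)
Section Coordinates.
Variables (F : finFieldType) (N : nat).
Local Notation V := 'rV[F]_N.+1.
Implicit Types (u v t : V) (W : {set V}) (f g : {mpoly F[N.+1]}).
Local Notation q := #|F|.

(** Indexing by natural numbers keeps the pairing of coordinates a matter of
    arithmetic; the index is meaningful for [k <= N]. *)
Definition coordinate k v : F := v 0 (inord k).

Definition basis_vector k : V := delta_mx 0 (inord k).

Lemma coordinate_linear_form k : linear_form (coordinate k).
Proof. by move=> a u v; rewrite /coordinate !mxE. Qed.

Lemma coordinateD k u v : coordinate k (u + v) = coordinate k u + coordinate k v.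
Proof. by rewrite /coordinate mxE. Qed.

Lemma coordinate_basis k j : (k <= N)%N -> (j <= N)%N ->
  coordinate k (basis_vector j) = (k == j)%:R.
Proof.
by move=> hk hj; rewrite /coordinate mxE eqxx /= -val_eqE /= !inordK.
Qed.

Lemma coordinate_eq0 v : (forall k, (k <= N)%N -> coordinate k v = 0) -> v = 0.
Proof.
move=> h; apply/rowP=> j; rewrite mxE -[RHS](h j) ?leq_ord //.
by rewrite /coordinate inord_val.
Qed.

Section Witt.
Variables (c m : nat) (core : V -> F).
Hypothesis hcm : (c + m.*2)%N = N.+1.
Hypothesis core_local :
  forall u v, (forall k, (k < c)%N -> coordinate k u = coordinate k v) ->
    core u = core v.
Hypothesis core_anisotropic :
  forall v, core v = 0 -> forall k, (k < c)%N -> coordinate k v = 0.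

(** The common shape of the three standard forms: an anisotropic core in the
    first [c] coordinates, followed by [m] products of consecutive
    coordinates. *)
Definition pair_form v :=
  core v +
  \sum_(i < m) coordinate (c + i.*2) v * coordinate (c + i.*2).+1 v.

Hypothesis hQ : quadratic pair_form.

Definition first_coords l :=
  [set v : V | [forall j : 'I_N.+1, (l <= j)%N ==> (v 0 j == 0)]].

Lemma first_coordsP l v :
  reflect (forall k, (l <= k)%N -> (k <= N)%N -> coordinate k v = 0)
          (v \in first_coords l).
Proof.
rewrite inE; apply: (iffP forallP) => h.
  by move=> k lk kN; have /implyP := h (inord k); rewrite inordK // => /(_ lk)/eqP.
by move=> j; apply/implyP => lj; rewrite -(h j lj (leq_ord j)) /coordinate inord_val.
Qed.

Lemma first_coords_subspace l : subspace (first_coords l).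
Proof.
split=> [|a u v /first_coordsP hu /first_coordsP hv];
  apply/first_coordsP => k lk kN.
  by rewrite /coordinate mxE.
by rewrite coordinate_linear_form hu // hv // mulr0 addr0.
Qed.

Lemma core_basis v k : (c <= k)%N -> (k <= N)%N ->
  core (v + basis_vector k) = core v.
Proof.
move=> ck kN; apply: core_local => j jc.
rewrite coordinateD coordinate_basis //; last by lia.
by rewrite (_ : (j == k) = false) ?addr0 //; lia.
Qed.

Lemma pair_form_basisl i v : (i < m)%N ->
  pair_form (v + basis_vector (c + i.*2)) = pair_form v + coordinate (c + i.*2).+1 v.
Proof.
move=> im; rewrite /pair_form core_basis; [|lia|lia].
rewrite -addrA; congr (_ + _).
rewrite [LHS](bigD1 (Ordinal im)) //= [in RHS](bigD1 (Ordinal im)) //=.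
rewrite !coordinateD !coordinate_basis; try lia.
rewrite eqxx (_ : (_ == _) = false); last by lia.
rewrite addr0 mulrDl mul1r addrAC; congr (_ + _ + _).
apply: eq_bigr => j ji; rewrite !coordinateD !coordinate_basis;
  try (by have := ltn_ord j; lia).
have {}ji : (j : nat) != i by [].
have e1 : (c + j.*2 == c + i.*2)%N = false by lia.
have e2 : ((c + j.*2).+1 == c + i.*2)%N = false by lia.
by rewrite e1 e2 !addr0.
Qed.

Lemma pair_form_basisr i v : (i < m)%N ->
  pair_form (v + basis_vector (c + i.*2).+1) = pair_form v + coordinate (c + i.*2) v.
Proof.
move=> im; rewrite /pair_form core_basis; [|lia|lia].
rewrite -addrA; congr (_ + _).
rewrite [LHS](bigD1 (Ordinal im)) //= [in RHS](bigD1 (Ordinal im)) //=.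
rewrite !coordinateD !coordinate_basis; try lia.
rewrite eqxx (_ : (_ == _) = false); last by lia.
rewrite addr0 mulrDr mulr1 addrAC; congr (_ + _ + _).
apply: eq_bigr => j ji; rewrite !coordinateD !coordinate_basis;
  try (by have := ltn_ord j; lia).
have {}ji : (j : nat) != i by [].
have e1 : (c + j.*2 == (c + i.*2).+1)%N = false by lia.
have e2 : ((c + j.*2).+1 == (c + i.*2).+1)%N = false by lia.
by rewrite e1 e2 !addr0.
Qed.

Lemma basis_first k l : (k < l)%N -> (k <= N)%N -> basis_vector k \in first_coords l.
Proof.
move=> kl kN; apply/first_coordsP => j lj jN; rewrite coordinate_basis //.
by rewrite (_ : (j == k) = false) //; lia.
Qed.

Lemma basis_pair i : (i < m)%N -> hyperbolic_pair pair_form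
  (first_coords (c + i.+1.*2))
  (basis_vector (c + i.*2)) (basis_vector (c + i.*2).+1).
Proof.
move=> im; have Q0 := quad0 hQ.
have e1 : pair_form (basis_vector (c + i.*2)) = 0.
  by rewrite -[basis_vector _]add0r pair_form_basisl // Q0 /coordinate mxE addr0.
have e2 : pair_form (basis_vector (c + i.*2).+1) = 0.
  by rewrite -[basis_vector _]add0r pair_form_basisr // Q0 /coordinate mxE addr0.
split=> //; try (by apply: basis_first; lia).
rewrite /polar pair_form_basisr // e1 e2 add0r !subr0.
by rewrite coordinate_basis ?eqxx //; lia.
Qed.

(** The spaces on the first [c + 2 * i] coordinates are nested, each being the
    complement in the next of the hyperbolic pair of the two new basis vectors.
    The smallest one carries only the anisotropic core, where zero is the only
    singular vector. *)
Lemma singular_bound_coords i : (i <= m)%N ->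
  singular_bound pair_form (first_coords (c + i.*2)) (q ^ i).
Proof.
elim: i => [_|i IH im] W hW sW W0.
  have -> : W = [set 0].
    apply/setP=> v; rewrite inE; apply/idP/eqP => [hv|->]; last by case: hW.
    have /first_coordsP hv0 := subsetP sW v hv; rewrite addn0 in hv0.
    apply: coordinate_eq0 => k kN; have [ck|kc] := leqP c k; first exact: hv0.
    apply: core_anisotropic kc; have := W0 v hv.
    rewrite /pair_form big1 ?addr0 // => j _.
    by rewrite hv0 ?mul0r //; have := ltn_ord j; lia.
  by rewrite cards1.
rewrite expnS; apply: (singular_bound_hyperbolic hQ _ (basis_pair im)) sW W0 => //.
  exact: first_coords_subspace.
move=> W' hW' sW' W'0; apply: IH => //; first exact: ltnW.
apply/subsetP=> t /(subsetP sW')/perpP[/first_coordsP ht t1 t2].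
have e1 : coordinate (c + i.*2).+1 t = 0.
  move: t1; rewrite /polar pair_form_basisl //; have [_ _ -> _ _] := basis_pair im.
  by rewrite subr0 addrAC subrr add0r.
have e2 : coordinate (c + i.*2) t = 0.
  move: t2; rewrite /polar pair_form_basisr //; have [_ _ _ -> _] := basis_pair im.
  by rewrite subr0 addrAC subrr add0r.
apply/first_coordsP => k ck kN.
have [->//|k1] := eqVneq k (c + i.*2)%N.
have [->//|k2] := eqVneq k (c + i.*2).+1.
by apply: ht => //; lia.
Qed.

Lemma singular_bound_pair_form : singular_bound pair_form [set: V] (q ^ m).
Proof.
move=> W hW _ W0; apply: (singular_bound_coords (leqnn m)) => //.
by apply/subsetP=> v _; apply/first_coordsP => k; rewrite hcm; lia.
Qed.
End Witt.
End Coordinates.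

(** * Non-singular quadrics *)
Section Standard.
Variables (F : finFieldType).
Local Notation q := #|F|.

Lemma meval0_nonunit n (g : {mpoly F[n]}) : g.@[fun _ => 0] = 0 ->
  g \isn't a GRing.unit.
Proof.
move=> g0; apply/negP => /(rmorph_unit (meval (fun _ : 'I_n => 0 : F))).
by rewrite /= g0 unitr0.
Qed.

(** A nontrivial zero of a binary quadratic form yields a linear factor. *)
Lemma irreducible_anisotropic (g : {mpoly F[2]}) (y : 'rV[F]_2) :
  g \is 2.-homog -> irreducible_mpoly g -> eval_form g y = 0 -> y = 0.
Proof.
move=> hg [g0 _ irr] gy; have [c [hc eg]] := dhomog2E hg.
have reducible (l1 l2 : {mpoly F[2]}) :
    l1.@[fun=> 0] = 0 -> l2.@[fun=> 0] = 0 -> g <> l1 * l2.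
  move=> h1 h2 /irr.
  by case=> hu; [have := meval0_nonunit h1|have := meval0_nonunit h2]; rewrite hu.
pose i0 : 'I_2 := ord0; pose i1 : 'I_2 := lift ord0 ord0.
have hom l a b : l = a *: 'X_i0 + b *: 'X_i1 -> l.@[fun=> 0] = 0 :> F.
  by move=> ->; rewrite mevalD !mevalZ !mevalXU !mulr0 addr0.
have eg' : g = c i0 i0 *: 'X_i0 ^+ 2 + c i0 i1 *: ('X_i0 * 'X_i1)
               + c i1 i1 *: 'X_i1 ^+ 2.
  rewrite eg !big_ord_recl !big_ord0 !addr0 (hc (lift ord0 ord0) ord0) //.
  by rewrite scale0r add0r.
move: gy; rewrite /eval_form eg' !mevalD !mevalZ !rmorphXn /= mevalM !mevalXU.
set a := c _ _; set b := c i0 i1; set d := c i1 i1.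
set y0 := y 0 i0; set y1 := y 0 i1 => gy.
have [y00|y00] := eqVneq y0 0; last first.
  case: (reducible ('X_i1 - (y1 / y0) *: 'X_i0)
                   (d *: 'X_i1 + (b + d * (y1 / y0)) *: 'X_i0)).
  - by apply: (hom _ (- (y1 / y0)) 1); rewrite scale1r scaleNr addrC.
  - by apply: (hom _ (b + d * (y1 / y0)) d); rewrite addrC.
  (* the coefficient [a] is forced by the zero [(1, y1 / y0)] of [g] *)
  have ea : a = - (y1 / y0) * (b + d * (y1 / y0)).
    apply: (mulIf (expf_neq0 2 y00)); apply/eqP; rewrite -subr_eq0 -gy.
    by apply/eqP; field; exact: y00.
  rewrite eg' -/a -/b -/d ea -!mul_mpolyC !(mpolyCD, mpolyCM, mpolyCN).
  ring.
have [y10|y10] := eqVneq y1 0; last first.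
  case: (reducible 'X_i0 (a *: 'X_i0 + b *: 'X_i1)).
  - by rewrite mevalXU.
  - exact: (hom _ a b).
  move/eqP: gy; rewrite y00 expr0n mul0r !mulr0 !add0r mulf_eq0 expf_eq0 /=.
  rewrite (negbTE y10) orbF => /eqP d0; rewrite eg' -/a -/b -/d d0 -!mul_mpolyC mpolyC0; ring.
by apply/rowP => j; rewrite mxE; case: (unliftP ord0 j) => [k|] ->; rewrite ?(ord1 k).
Qed.

Variable N : nat.
Local Notation V := 'rV[F]_N.+1.
Implicit Types (f g : {mpoly F[N.+1]}) (v : V).

Lemma eval_linear_change g A v :
  eval_form (g \mPo linear_change A) v = eval_form g (v *m A^T).
Proof.
rewrite /eval_form comp_mpoly_meval; apply: meval_eq => i.
rewrite tnth_mktuple raddf_sum mxE; apply: eq_bigr => j _.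
by rewrite /= mevalZ mevalXU mxE mulrC.
Qed.

Lemma singular_bound_equiv f g M : proj_equiv f g ->
  singular_bound (eval_form g) [set: V] M ->
  singular_bound (eval_form f) [set: V] M.
Proof.
case=> A uA [c c0 e] hM W hW _ W0.
pose L v := v *m A^T.
have uAT : A^T \in unitmx by rewrite unitmx_tr.
have injL : injective L by apply: (can_inj (mulmxK uAT)).
rewrite -(card_imset W injL); apply: hM => //.
  split=> [|a _ _ /imsetP[t ht ->] /imsetP[u hu ->]].
    by apply/imsetP; exists 0; [case: hW|rewrite /L mul0mx].
  apply/imsetP; exists (a *: t + u); first exact: subspace_comb.
  by rewrite /L mulmxDl scalemxAl.
move=> _ /imsetP[t ht ->].
by rewrite /L -eval_linear_change e /eval_form mevalZ -/(eval_form f t) W0 ?mulr0.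
Qed.

Lemma quadratic_pair_form c m (core : V -> F) :
  quadratic core -> quadratic (pair_form c m core).
Proof.
move=> h; apply: quadraticD => //; apply: quadratic_sum => i.
by apply: quadraticM; apply: coordinate_linear_form.
Qed.

Lemma singular_bound_ext (Q Q' : V -> F) U M : Q =1 Q' ->
  singular_bound Q U M -> singular_bound Q' U M.
Proof. by move=> e h W hW sW W0; apply: h => // t /W0; rewrite e. Qed.

Lemma eval_coordX k v : (coordX F N k).@[fun i => v 0 i] = coordinate k v.
Proof. by rewrite /coordX mevalXU. Qed.

Lemma parabolic_bound f : is_parabolic f ->
  singular_bound (eval_form f) [set: V] (q ^ N./2).
Proof.
case=> oN /singular_bound_equiv; apply.
pose core v := coordinate 0 v * coordinate 0 v.
apply: (@singular_bound_ext (pair_form 1 N./2 core)).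
  move=> v; rewrite /eval_form mevalD rmorphXn /= eval_coordX expr2; congr (_ + _).
  rewrite big_add1 big_mkord raddf_sum; apply: eq_bigr => i _.
  by rewrite /= mevalM !eval_coordX; congr (coordinate _ v * coordinate _ v); lia.
apply: singular_bound_pair_form.
- lia.
- by move=> u v h; rewrite /core h.
- by move=> v /eqP; rewrite mulf_eq0 orbb => /eqP e [|//] _.
- by apply: quadratic_pair_form; apply: quadraticM; apply: coordinate_linear_form.
Qed.

Lemma hyperbolic_bound f : is_hyperbolic f ->
  singular_bound (eval_form f) [set: V] (q ^ N./2.+1).
Proof.
case=> oN /singular_bound_equiv; apply.
apply: (@singular_bound_ext (pair_form 0 N./2.+1 (fun=> 0))).
  move=> v; rewrite /pair_form add0r /eval_form /hyperbolic_form big_mkord raddf_sum.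
  apply: eq_bigr => i _.
  by rewrite /= mevalM !eval_coordX; congr (coordinate _ v * coordinate _ v); lia.
apply: singular_bound_pair_form => //; first by lia.
by apply: quadratic_pair_form; apply: quadratic0.
Qed.

Lemma elliptic_bound f : is_elliptic f ->
  singular_bound (eval_form f) [set: V] (q ^ N./2).
Proof.
case=> oN [g [hg irr /singular_bound_equiv]]; apply.
pose L v : 'rV[F]_2 := \row_i coordinate i v.
apply: (@singular_bound_ext (pair_form 2 N./2 (eval_form g \o L))).
  move=> v; rewrite /eval_form mevalD comp_mpoly_meval; congr (_ + _).
    apply: meval_eq => i; rewrite mxE (tnth_nth 0) /=.
    by case: i => [[|[|//]]] i2; rewrite /= eval_coordX.
  rewrite big_add1 big_mkord raddf_sum; apply: eq_bigr => i _.
  by rewrite /= mevalM !eval_coordX; congr (coordinate _ v * coordinate _ v); lia.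
apply: singular_bound_pair_form.
- lia.
- by move=> u v h; congr (eval_form g _); apply/rowP => j; rewrite !mxE h.
- move=> v /= /(irreducible_anisotropic hg irr) /rowP e k k2.
  by have := e (Ordinal k2); rewrite !mxE.
- apply: quadratic_pair_form; apply: quadratic_comp (quadratic_eval hg).
  by move=> a u v; apply/rowP => j; rewrite !mxE coordinate_linear_form.
Qed.

(** A totally singular subspace has dimension at most [N./2], or [N./2 + 1] in
    the hyperbolic case; the hypothesis on [N] makes this less than [N - 2]. *)
Lemma nonsingular_bound f W : nonsingular f ->
    ((6 <= N)%N \/ (N = 5%N /\ is_elliptic f)) ->
    subspace W -> {in W, forall t, eval_form f t = 0} ->
  (q ^ 3 * #|W| < #|V|)%N.
Proof.
move=> hns hN hW W0; have q1 := card_field_gt1 F.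
rewrite card_mx mul1n.
suff [m mN hm] : exists2 m, (m + 3 < N.+1)%N & (#|W| <= q ^ m)%N.
  apply: leq_ltn_trans (_ : q ^ (m + 3) < _)%N; last by rewrite ltn_exp2l.
  by rewrite addnC expnD leq_mul2l hm orbT.
have bd m : singular_bound (eval_form f) [set: V] (q ^ m) -> (#|W| <= q ^ m)%N.
  by apply=> //; apply: subsetT.
case: hN => [N6|[N5 ell]]; last first.
  by exists N./2; [rewrite N5|apply/bd/elliptic_bound].
case: hns => h; have oN := h.1.
- by exists N./2; [lia|apply/bd/parabolic_bound].
- by exists N./2.+1; [lia|apply/bd/hyperbolic_bound].
- by exists N./2; [lia|apply/bd/elliptic_bound].
Qed.
End Standard.

(** * Projective points, hyperplane pairs and the final count *)
Section Points.
Variables (F : finFieldType) (N : nat).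
Local Notation V := 'rV[F]_N.+1.
Local Notation q := #|F|.
Implicit Types (f g : {mpoly F[N.+1]}) (u v : V).

Lemma line_of_id v : v \in line_of v.
Proof. by apply/imsetP; exists 1; rewrite ?scale1r. Qed.

Lemma points_line f v : f \is 2.-homog -> v != 0 ->
  (line_of v \in points f) = (eval_form f v == 0).
Proof.
move=> hf v0; have hPG : line_of v \in PG F N by apply: imset_f; rewrite inE.
rewrite inE hPG /=; apply/forall_inP/eqP => [h|h u].
  by apply/eqP; apply: h (line_of_id v).
case/imsetP=> a _ ->; apply/eqP.
by rewrite -[LHS]/(eval_form f (a *: v)) (quadZ (quadratic_eval hf)) h mulr0.
Qed.

Lemma card_line_fiber u : u != 0 ->
  #|[set v : V | (v != 0) && (line_of v == line_of u)]| = q.-1.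
Proof.
move=> u0; rewrite -(cardC1 (0 : F)).
rewrite -(card_imset _ (f := fun a => a *: u)); last first.
  move=> a c /eqP; rewrite -subr_eq0 -scalerBl scaler_eq0 (negbTE u0) orbF.
  by rewrite subr_eq0 => /eqP.
apply: eq_card => v; rewrite inE; apply/andP/imsetP => [[v0 /eqP e]|[a]].
  have := line_of_id v; rewrite e => /imsetP[a _ ea]; exists a => //.
  by rewrite inE; apply: contraNneq v0 => a0; rewrite ea a0 scale0r.
rewrite inE => a0 ->; split; first by rewrite scaler_eq0 negb_or a0.
apply/eqP/setP=> w; apply/imsetP/imsetP => -[c _ ->].
  by exists (c * a); rewrite ?scalerA.
by exists (c / a); rewrite // scalerA divfK.
Qed.

Lemma card_common_points f g : f \is 2.-homog -> g \is 2.-homog ->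
  #|common (eval_form f) (eval_form g) :\ 0%R|
  = (#|points f :&: points g| * q.-1)%N.
Proof.
move=> hf hg; set S := _ :\ _.
have SE v : (v \in S) = (v != 0) && (line_of v \in points f :&: points g).
  rewrite !in_setD1; case v0 : (v != 0) => //=.
  by rewrite in_setI !points_line // inE.
have -> : points f :&: points g = @line_of F N @: S.
  apply/setP=> P; apply/idP/imsetP => [hP|[v + ->]]; last by rewrite SE => /andP[].
  have := hP; rewrite inE => /andP[+ _]; rewrite inE => /andP[/imsetP[v v0 e] _].
  by rewrite inE in v0; exists v; rewrite // SE -e hP andbT.
rewrite -sum1_card (partition_big_imset (@line_of F N)) /= -sum_nat_const.
apply: eq_bigr => _ /imsetP[u uS ->]; move: (uS); rewrite SE => /andP[u0 uP].
rewrite -(card_line_fiber u0) sum1dep_card; apply: eq_card => v.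
rewrite in_set [RHS]in_set SE; case: (v != 0) => //=.
by case: eqP => [->|]; rewrite ?uP ?andbF.
Qed.

Lemma pencil_neq0 f f' p : f != 0 -> f' != 0 -> ~ proportional f f' ->
  p != (0, 0) -> p.1 *: f + p.2 *: f' != 0.
Proof.
case: p => l m /= f0 f'0 hd p0; apply/eqP => e; apply: hd.
have [m0|m0] := eqVneq m 0.
  move/eqP: e; rewrite m0 scale0r addr0 scaler_eq0 (negbTE f0) orbF => /eqP l0.
  by move: p0; rewrite l0 m0 eqxx.
have e' : f' = (- (l / m)) *: f.
  apply: (scalerI m0); rewrite scalerA mulrN mulrCA mulfV // mulr1 scaleNr.
  by apply/eqP; rewrite -addr_eq0 addrC e.
exists (- (l / m)) => //; apply: contraNneq f'0 => c0.
by rewrite e' c0 scale0r.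
Qed.

(** The factors are [b _ w] and [b _ v].  They are not proportional because
    at [v] they take the values 1 and 0. *)
Lemma two_hyperplanes_pair h v w : h \is 2.-homog ->
    hyperbolic_pair (eval_form h) [set: V] v w ->
    {in perp (eval_form h) [set: V] v w, forall t, eval_form h t = 0} ->
  two_hyperplanes h.
Proof.
move=> hh hvw h0; have hQ := quadratic_eval hh.
have [_ _ v0 w0 vw] := hvw.
have lw := polar_linear hQ w; have lv := polar_linear hQ v.
exists (linear_mpoly (polar (eval_form h) ^~ w)).
exists (linear_mpoly (polar (eval_form h) ^~ v)).
have e1 := eval_linear_mpoly _ lw; have e2 := eval_linear_mpoly _ lv.
split.
- split; last exact: linear_mpoly_homog.
  apply/eqP => e; have := e1 v; rewrite e /eval_form meval0 vw => /esym/eqP.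
  by rewrite oner_eq0.
- split; last exact: linear_mpoly_homog.
  apply/eqP => e; have := e2 w; rewrite e /eval_form meval0 polarC vw => /esym/eqP.
  by rewrite oner_eq0.
- case=> c c0 e; have := e2 v.
  rewrite e /eval_form mevalZ -/(eval_form _ v) e1 vw mulr1.
  by rewrite (polar_singular hQ v0) => /eqP; rewrite (negbTE c0).
apply/eqP; rewrite -subr_eq0; apply/eqP/dhomog2_eq0.
  apply: rpredB => //.
  exact: (dhomogM (linear_mpoly_homog _) (linear_mpoly_homog _)).
move=> t; rewrite /eval_form mevalB mevalM -!/(eval_form _ t) e1 e2.
have tT : t \in [set: V] by rewrite in_setT.
rewrite (quad_split hQ (subspaceT V) hvw tT) h0 ?addr0 ?subrr //.
by apply: projection_perp => //; apply: subspaceT.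
Qed.

End Points.

Lemma geometric_sum y k :
  (y * (\sum_(1 <= i < k.+1) 2 * y.+1 ^ i) + 2 * y.+1 = 2 * (y.+1 * y.+1 ^ k))%N.
Proof.
elim: k => [|k IH]; first by rewrite big_geq // muln0 expn0 muln1.
rewrite big_nat_recr //= expnS; move: IH.
by move: (\sum_(_ <= _ < _) _)%N (y.+1 ^ k)%N => S T; lia.
Qed.

(** After division by [q ^ 5], the lower bound on [P * (q - 1)] exceeds the
    upper one by about [q ^ (k + 3)]. *)
Lemma bound_arith_average q k a P : (1 < q)%N -> a = (P * q.-1).+1 ->
    (q ^ (k + 3) + 3 * q ^ (k + 2) + 3 * q ^ (k + 1)
      + \sum_(1 <= i < k.+1) 2 * q ^ i + 1 < P)%N ->
  ~ (q ^ 5 * a + q ^ (k + 6) <= (q ^ 3 + q ^ 2) * q ^ (k + 6))%N.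
Proof.
case: q => [|y] //= y0 ->; have := geometric_sum y k.
rewrite !expnD; have : (0 < y.+1 ^ k)%N by rewrite expn_gt0.
move: (\sum_(_ <= _ < _) _)%N (y.+1 ^ k)%N => S T T0 hS hP hle.
have {}hle : ((P * y).+1 + y.+1 * T <= (y.+1 ^ 4 + y.+1 ^ 3) * T)%N.
  by rewrite -(leq_pmul2l (_ : 0 < y.+1 ^ 5)%N) ?expn_gt0 //; move: hle; lia.
have h1 := leq_mul hP (leqnn y).
have h2 : (1 < y.+1 ^ 3 * T)%N.
  by apply: leq_trans (leq_mul (_ : 2 <= y.+1 ^ 3)%N T0); rewrite // (ltn_exp2l 0).
lia.
Qed.

(** Here the bounds coincide: multiplying the lower bound for [P] by [q - 1]
    gives the upper bound for [P * (q - 1)], hence the strict inequality is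
    contradictory. *)
Lemma bound_arith_cone q k P : (1 < q)%N ->
    (q ^ (k + 3) + 3 * q ^ (k + 2) + 3 * q ^ (k + 1)
      + \sum_(1 <= i < k.+1) 2 * q ^ i + 1 < P)%N ->
  ~ (q ^ 5 * (P * q.-1) + q.+1 * (q ^ 5 + q ^ (k + 6)) <=
     q.+1 * ((q ^ 2 + q) * q ^ (k + 6)))%N.
Proof.
case: q => [|y] //= y0; have := geometric_sum y k; rewrite !expnD.
move: (\sum_(_ <= _ < _) _)%N (y.+1 ^ k)%N => S T hS hP hle.
have {}hle : (P * y + y.+2 * (1 + y.+1 * T)
              <= y.+2 * ((y.+1 ^ 2 + y.+1) * (y.+1 * T)))%N.
  by rewrite -(leq_pmul2l (_ : 0 < y.+1 ^ 5)%N) ?expn_gt0 //; move: hle; lia.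
have h1 := leq_mul hP (leqnn y).
lia.
Qed.

Theorem theorem2p1 (F : finFieldType) (q N : nat) (hq : #|F| = q)
  (f f' : {mpoly F[N.+1]})
  (hf : is_quadric f) (hns : nonsingular f)
  (hN : (6 <= N)%N \/ (N = 5%N /\ is_elliptic f))
  (hf' : is_quadric f') (hdist : ~ proportional f f')
  (hcard : (q ^ (N - 2) + 3 * q ^ (N - 3) + 3 * q ^ (N - 4)
            + \sum_(1 <= i < (N - 5).+1) 2 * q ^ i + 1
            < #|points f :&: points f'|)%N) :
  exists h : {mpoly F[N.+1]}, in_pencil f f' h /\ two_hyperplanes h.
Proof.
case: hf hf' => f0 hf [f'0 hf'].
have q1 : (1 < q)%N by rewrite -hq; apply: card_field_gt1.
have hQ := quadratic_eval hf; have hQ' := quadratic_eval hf'.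
have [k hk] : exists k, N = (k + 5)%N by exists (N - 5)%N; case: hN; lia.
have cV : #|'rV[F]_N.+1| = (q ^ (k + 6))%N by rewrite card_mx mul1n hq hk -addnS.
have cS := card_common_points hf hf'; rewrite hq in cS.
have {}hcard : (q ^ (k + 3) + 3 * q ^ (k + 2) + 3 * q ^ (k + 1)
  + \sum_(1 <= i < k.+1) 2 * q ^ i + 1 < #|points f :&: points f'|)%N.
  have [e2 e3 e4 e5] :
    [/\ N - 2 = k + 3, N - 3 = k + 2, N - 4 = k + 1 & N - 5 = k]%N.
    by split; lia.
  by move: hcard; rewrite e2 e3 e4 e5.
pose h p := p.1 *: f + p.2 *: f'.
have hh p : h p \is 2.-homog by apply: rpredD; apply: rpredZ.
have hR : is_pencil (eval_form f) (eval_form f') (fun p => eval_form (h p)).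
  by move=> p v; apply: eval_pencil.
(* Unless a member of the pencil is a sum of at most two products, the
   average size of the members contradicts the size of the intersection. *)
have [[p p0 hp]|] := pencil_average hR (fun p => quadratic_eval (hh p)); last first.
  rewrite hq cV => /(bound_arith_average q1 _ hcard); case=> //.
  by rewrite (cardsD1 0) cS inE (quad0 hQ) (quad0 hQ') eqxx.
exists (h p); split.
  by exists p.1, p.2; split; [case: (p) p0|].
case: hp => [h0|[v1 [w1 [h1 [h0|[v2 [w2 [h2 [h0|//]]]]]]]]].
- case/eqP: (pencil_neq0 f0 f'0 hdist p0); apply: (dhomog2_eq0 (hh p)) => v.
  exact: h0.
- exact: two_hyperplanes_pair h1 h0.
have hW W : subspace W -> {in W, forall t, eval_form f t = 0} ->
    (#|F| ^ 3 * #|W| < #|'rV[F]_N.+1|)%N.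
  exact: nonsingular_bound hns hN.
have := cone_bound hQ (quadratic_eval (hh p)) hW h1 h2 h0.
rewrite hq cV => hle; case: (bound_arith_cone q1 hcard); apply: leq_trans hle.
(* A common zero of [f] and [f'] is a zero of the cone. *)
rewrite leq_add2r leq_mul2l -cS subset_leq_card ?orbT //.
apply/subsetP=> v; rewrite !inE => /and3P[-> /eqP fv /eqP f'v].
by rewrite hR fv f'v !mulr0 addr0 !eqxx.
Qed.
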